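(* Let $d=2$, $1<p<2$, let $\beta\in\mathbb{R}$ and let $A_\beta$ be the Aharonov--Bohm potential $$A_\beta(x)=\beta\,\frac{(x_2,-x_1)}{|x|^2},\qquad x=(x_1,x_2)\in\mathbb{R}^2\setminus\{0\}.$$ If $\beta\notin\mathbb{Z}$, then there exists a constant $$\lambda_\beta(p)>\left(\frac{2-p}{p}\right)^p$$ such that $$\int_{\mathbb{R}^2}|\nabla_{A_\beta}u|^p\,dx\;\geq\;\lambda_\beta(p)\int_{\mathbb{R}^2}\frac{|u|^p}{|x|^p}\,dx,\qquad\forall u\in C_c^\infty(\mathbb{R}^2).$$
   Context: The functions $u$ are complex-valued, and the magnetic gradient is $\nabla_{A_\beta}u:=\nabla u+iA_\beta(x)u$ (defined for $x\neq0$). *)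

(* Defs.v *)
From HB Require Import structures.
From mathcomp Require Import all_boot all_order all_algebra.
From mathcomp Require Import all_classical all_reals all_analysis.
From mathcomp Require Import complex.

Set Implicit Arguments.
Unset Strict Implicit.
Unset Printing Implicit Defensive.
Import Order.TTheory GRing.Theory Num.Theory.
Import numFieldNormedType.Exports.

Local Open Scope classical_set_scope.
Local Open Scope ring_scope.

Section magnetic.
Context {R : realType}.
Implicit Types (f : R * R -> R) (u : R * R -> R[i]) (x : R * R).

(* The library norm of R * R is the max norm, and the library norm of R[i] is
   R[i]-valued; hence the Euclidean norms below and the real-valued normc. *)
Definition norm2 x : R := Num.sqrt (x.1 ^+ 2 + x.2 ^+ 2).

Definition normC2 (z : R[i] * R[i]) : R :=
  Num.sqrt (Normc.normc z.1 ^+ 2 + Normc.normc z.2 ^+ 2).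

Definition basis1 : R * R := (1, 0).
Definition basis2 : R * R := (0, 1).

Fixpoint of_class_C (k : nat) f : Prop :=
  match k with
  | 0 => continuous f
  | k'.+1 =>
      [/\ continuous f,
          forall x, derivable f x basis1 /\ derivable f x basis2,
          of_class_C k' ('D_basis1 f) &
          of_class_C k' ('D_basis2 f)]
  end.

Definition smooth f : Prop := forall k, of_class_C k f.

Definition re_fun u : R * R -> R := fun x => complex.Re (u x).
Definition im_fun u : R * R -> R := fun x => complex.Im (u x).

Definition test_function u : Prop :=
  [/\ smooth (re_fun u), smooth (im_fun u) &
      compact (closure [set x | u x != 0])].

Definition partialC (v : R * R) u x : R[i] :=
  ('D_v (re_fun u) x +i* 'D_v (im_fun u) x)%C.

(* At x = 0, where the potential is undefined in the mathematics, division by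
   zero makes this 0; this only affects the integrands on a null set. *)
Definition AB_potential (beta : R) x : R * R :=
  (beta * (x.2 / norm2 x ^+ 2), beta * (- x.1 / norm2 x ^+ 2)).

Definition magnetic_gradient (A : R * R -> R * R) u x : R[i] * R[i] :=
  (partialC basis1 u x + 'i%C * (A x).1%:C%C * u x,
   partialC basis2 u x + 'i%C * (A x).2%:C%C * u x).

Definition leb2 := ((@lebesgue_measure R) \x (@lebesgue_measure R))%E.

End magnetic.

(* Main.v *)
(* Let E and D be the moduli of the radial derivative x.grad u and of the
   covariant angular derivative (x_1 d_2 - x_2 d_1) u - i beta u, so that
   |x|^2 |grad_A u|^2 = E^2 + D^2. Writing u(x) through its increments along the
   dilations e^t x, averaging over t with Jensen's inequality and changing
   variables gives the radial Hardy inequality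
     int E^p/|x|^p >= ((2-p)/p)^p int |u|^p/|x|^p.
   The same argument along the rotations R_t x, 0 <= t <= 2 pi, gives
     int D^p/|x|^p >= kappa int |u|^p/|x|^p   with kappa > 0,
   because the holonomy e^(-2 i pi beta) is not 1. No polar coordinates are
   needed: dilations and rotations are conformal linear maps, whose Jacobian is
   computed by Tonelli's theorem. Finally, concavity of r^(p/2) bounds
   |grad_A u|^p below by (1-e) E^p/|x|^p + e^(1-p/2) D^p/|x|^p, and for small e
   the gain e^(1-p/2) kappa beats the loss e ((2-p)/p)^p. *)
Require Import Defs.
From HB Require Import structures.
From mathcomp Require Import all_boot all_order all_algebra.
From mathcomp Require Import all_classical all_reals all_analysis.
From mathcomp Require Import complex.
From mathcomp Require Import measurable_realfun ring lra.
Set Implicit Arguments.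
Unset Strict Implicit.
Unset Printing Implicit Defensive.
Import Order.TTheory GRing.Theory Num.Theory.
Import numFieldNormedType.Exports.

Local Open Scope classical_set_scope.
Local Open Scope ring_scope.

(** * Sigma-finiteness and Borel measurability on the plane *)

Section leb2_sigma_finite.
Context {R : realType}.

(* Inference on a product of measures finds the instance for products of
   subprobabilities, so leb2 needs its own sigma-finite structure. *)
HB.instance Definition _ := Measure.on (@leb2 R).

Let leb2_sigma_finite : sigma_finite setT (@leb2 R).
Proof.
pose I n : set R := `[- n%:R, n%:R]%classic.
have Ifin n : (lebesgue_measure (I n) < +oo)%E.
  by rewrite lebesgue_measure_itv/=; case: ifP => // _; rewrite -EFinB ltry.
exists (fun n => I n `*` I n); last first.
  move=> n.
  split; first by apply: measurableX; exact: measurable_itv.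
  rewrite [X in (X < _)%E]product_measure1E; try exact: measurable_itv.
  by apply: lte_mul_pinfty; rewrite ?ge0_fin_numE; try exact: measure_ge0;
    exact: Ifin.
apply/seteqP; split => // x _.
exists (Num.bound (Num.max `|x.1| `|x.2|)) => //.
have : Num.max `|x.1| `|x.2| < (Num.bound (Num.max `|x.1| `|x.2|))%:R.
  by apply: archi_boundP; rewrite le_max normr_ge0.
rewrite gt_max => /andP[/ltW + /ltW +]; rewrite !ler_norml.
by split; rewrite /I/= in_itv/=.
Qed.

HB.instance Definition _ :=
  Measure_isSigmaFinite.Build _ _ _ (@leb2 R) leb2_sigma_finite.

End leb2_sigma_finite.

(** The plane carries the product sigma-algebra, so an open set has to be written as a countable
    union of measurable rectangles: the rational open boxes that it contains. *)
Lemma continuous_measurable_prod {R : realType} (f : R * R -> R) :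
  continuous f -> measurable_fun [set: R * R] f.
Proof.
move=> cf; apply: (measurability _ (RGenOInfty.measurableE R)) => //.
move=> _ [_ [a ->] <-]; rewrite setTI preimage_itvoy.
set O := [set x | a < f x].
pose S (q : rat * rat * rat * rat) : set (R * R) :=
  `]ratr q.1.1.1, ratr q.1.1.2[ `*` `]ratr q.1.2, ratr q.2[.
have oO : open O.
  apply: (@open_comp _ _ f [set y | a < y]) => [x _|]; first exact: cf.
  exact: open_gt.
suff -> : O = \bigcup_q (if `[< S q `<=` O >] then S q else set0).
  apply: countable_bigcupT_measurable => // q.
  by case: ifP => _ //; apply: measurableX => //; exact: measurable_itv.
apply/seteqP; split => x; last first.
  by move=> [q _]; case: ifPn => // /asboolP SO /SO.
move=> Ox; have /nbhs_ballP[e /= e0 xeO] : nbhs x O by exact: open_nbhs_nbhs.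
have rat_near (y : R) : exists2 q : rat * rat,
    ratr q.1 < y < ratr q.2 & y - e < ratr q.1 /\ ratr q.2 < y + e.
  have /rat_in_itvoo[q1] : y - e < y by rewrite ltrBlDr ltrDl.
  have /rat_in_itvoo[q2] : y < y + e by rewrite ltrDl.
  rewrite !in_itv/= => /andP[a1 a2] /andP[b1 b2].
  by exists (q1, q2); rewrite /= ?a1 ?a2 ?b1 ?b2.
have [[q1 q2] /= q12 [q1e q2e]] := rat_near x.1.
have [[q3 q4] /= q34 [q3e q4e]] := rat_near x.2.
exists (q1, q2, q3, q4) => //.
rewrite asboolT; first by split; rewrite /= in_itv.
move=> [y1 y2] [/=]; rewrite !in_itv/= => /andP[y11 y12] /andP[y21 y22].
apply: xeO; split; rewrite /ball/= ltr_distl.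
  by rewrite ltrBlDr; lra.
by rewrite ltrBlDr; lra.
Qed.

(** * Affine substitutions on the line and conformal linear ones on the plane *)

Section change_of_variables.
Context {R : realType}.
Local Notation mu := (@lebesgue_measure R).
Local Open Scope ereal_scope.

(** The image of Lebesgue measure under [phi], scaled by [a], gives half-open intervals their
    length, and is therefore Lebesgue measure. *)
Let ge0_integral_affine_gt0 (a b : R) (f : R -> \bar R) : (0 < a)%R ->
  measurable_fun setT f -> (forall x, 0 <= f x) ->
  \int[mu]_x f (a * x + b)%R = (a^-1)%:E * \int[mu]_x f x.
Proof.
move=> a0 mf f0.
pose phi : measurableTypeR R -> measurableTypeR R := (fun x => a * x + b)%R.
have mphi : measurable_fun setT phi.
  by apply: measurable_funD => //; exact: measurable_funM.
have a_ge0 : (0 <= a)%R by exact: ltW.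
pose m : {measure set (measurableTypeR R) -> \bar R} :=
  measure_function_pushforward__canonical__measure_function_Measure mu mphi.
have muE : forall A, measurable A -> mu A = mscale (NngNum a_ge0) m A.
  apply: lebesgue_measure_unique => _ [[x y] _ <-].
  change (mu `]x, y] = a%:E * mu (phi @^-1` `]x, y])).
  rewrite (_ : phi @^-1` _ = `]((x - b) / a)%R, ((y - b) / a)%R]%classic);
    last first.
    apply/seteqP; split => t /=; rewrite !in_itv/= /phi.
      by rewrite ltr_pdivrMr// ler_pdivlMr// ltrBlDr lerBrDr mulrC.
    by rewrite ltr_pdivrMr// ler_pdivlMr// ltrBlDr lerBrDr mulrC.
  rewrite !lebesgue_measure_itv/= !lte_fin ltr_pM2r ?invr_gt0// ltrD2r.
  case: ifPn => _; last by rewrite mule0.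
  by rewrite -!EFinD -EFinM; congr EFin; field; rewrite gt_eqF.
rewrite -[LHS](_ : \int[m]_x f x = _); last first.
  by rewrite /m/= ge0_integral_pushforward//= preimage_setT.
rewrite [X in _ * X](_ : _ = \int[mscale (NngNum a_ge0) m]_x f x); last first.
  by apply: eq_measure_integral => A mA _; exact: muE.
by rewrite ge0_integral_mscale//= muleA -EFinM mulVf ?gt_eqF// mul1e.
Qed.

Lemma ge0_integral_affine (a b : R) (f : R -> \bar R) : a != 0%R ->
  measurable_fun setT f -> (forall x, 0 <= f x) ->
  \int[mu]_x f (a * x + b)%R = (`|a|^-1)%:E * \int[mu]_x f x.
Proof.
move=> a0 mf f0; have [a_gt0|a_lt0|a00] := ltgtP 0%R a;
  last by rewrite a00 eqxx in a0.
  by rewrite gtr0_norm//; exact: ge0_integral_affine_gt0.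
(* A negative slope reduces to a positive one by reflection, which preserves Lebesgue measure. *)
have intN (g : R -> \bar R) : measurable_fun setT g -> (forall x, 0 <= g x) ->
    \int[mu]_x g (- x)%R = \int[mu]_x g x.
  move=> mg g0.
  transitivity (\int[pushforward mu (-%R : _ -> measurableTypeR R)]_x g x).
    by rewrite ge0_integral_pushforward//= preimage_setT.
  by apply: eq_measure_integral => A mA _; exact: lebesgue_measureN.
rewrite ltr0_norm// -[in LHS](opprK a).
under eq_integral do rewrite mulNr -mulrN.
rewrite (intN (fun x => f (- a * x + b)%R)); last 2 first.
- have mg : measurable_fun setT (fun x : R => (- a * x + b)%R).
    by apply: measurable_funD => //; exact: measurable_funM.
  exact: (measurableT_comp mf mg).
- by [].
by apply: ge0_integral_affine_gt0; rewrite ?oppr_gt0.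
Qed.

Let tonelli1 (f : R * R -> \bar R) :
  measurable_fun setT f -> (forall x, 0 <= f x) ->
  \int[leb2]_x f x = \int[mu]_x \int[mu]_y f (x, y).
Proof.
move=> mf f0.
exact: (@fubini_tonelli1 _ _ (measurableTypeR R) (measurableTypeR R) _
  mu mu f mf f0).
Qed.

Let tonelli2 (f : R * R -> \bar R) :
  measurable_fun setT f -> (forall x, 0 <= f x) ->
  \int[leb2]_x f x = \int[mu]_y \int[mu]_x f (x, y).
Proof.
move=> mf f0.
exact: (@fubini_tonelli2 _ _ (measurableTypeR R) (measurableTypeR R) _
  mu mu f mf f0).
Qed.

Let measurable_integral1 (f : R * R -> \bar R) :
  measurable_fun setT f -> (forall x, 0 <= f x) ->
  measurable_fun setT (fun x => \int[mu]_y f (x, y)).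
Proof.
move=> mf f0; exact: (@measurable_fun_fubini_tonelli_F _ _ (measurableTypeR R)
  (measurableTypeR R) _ mu f mf f0).
Qed.

Let measurable_integral2 (f : R * R -> \bar R) :
  measurable_fun setT f -> (forall x, 0 <= f x) ->
  measurable_fun setT (fun y => \int[mu]_x f (x, y)).
Proof.
move=> mf f0; exact: (@measurable_fun_fubini_tonelli_G _ _ (measurableTypeR R)
  (measurableTypeR R) _ mu f mf f0).
Qed.

Let integralZ (k : R) (g : R -> \bar R) : (0 <= k)%R ->
  measurable_fun setT g -> (forall x, 0 <= g x) ->
  \int[mu]_x (k%:E * g x) = k%:E * \int[mu]_x g x.
Proof. by move=> k0 mg g0; apply: ge0_integralZl => // *; exact: g0. Qed.

(** Two affine substitutions under Tonelli's theorem: one in [x], with factor 1/|a|, then one in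
    [y], with factor 1/|k|, where |a| |k| = a^2 + b^2. When [a = 0] the map only swaps and scales
    the coordinates. *)
Lemma ge0_integral_conformal (a b : R) (f : R * R -> \bar R) :
  (0 < a ^+ 2 + b ^+ 2)%R ->
  measurable_fun setT f -> (forall x, 0 <= f x) ->
  \int[leb2]_x f (a * x.1 - b * x.2, b * x.1 + a * x.2)%R =
  ((a ^+ 2 + b ^+ 2)^-1)%:E * \int[leb2]_x f x.
Proof.
move=> ab0 mf f0.
have mlin (c d : R) : measurable_fun setT (fun x : R => c * x + d)%R.
  by apply: measurable_funD => //; exact: measurable_funM.
have msec1 x : measurable_fun setT (fun y => f (x, y)).
  exact: measurableT_comp (pair1_measurable x).
have msec2 y : measurable_fun setT (fun x => f (x, y)).
  exact: measurableT_comp (pair2_measurable y).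
have mF := measurable_integral1 mf f0.
pose F x := \int[mu]_y f (x, y).
have F0 x : 0 <= F x by exact: integral_ge0.
have mM : measurable_fun setT
    (fun x : R * R => f (a * x.1 - b * x.2, b * x.1 + a * x.2)%R).
  have h : measurable_fun setT (fun x : R * R =>
      (a * x.1 - b * x.2, b * x.1 + a * x.2)%R).
    apply/measurable_fun_pairP; split.
      by apply: measurable_funB; apply: measurable_funM.
    by apply: measurable_funD; apply: measurable_funM.
  exact: (measurableT_comp mf h).
rewrite tonelli2//= [in RHS]tonelli1// -/F.
have [a0|a0] := eqVneq a 0%R.
  have b0 : b != 0%R.
    by apply: contraTneq ab0 => ->; rewrite a0 !expr0n/= addr0 ltxx.
  transitivity (\int[mu]_y ((`|b|^-1)%:E * F (- b * y + 0)%R)).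
    apply: eq_integral => y _; rewrite addr0.
    rewrite -(ge0_integral_affine 0 b0)//.
    apply: eq_integral => x _; congr (f (_, _)).
      by rewrite a0 mul0r sub0r mulNr.
    by rewrite a0 mul0r.
  rewrite (integralZ _ (measurableT_comp mF (mlin (- b)%R 0%R)));
    [|by rewrite invr_ge0|by move=> y; exact: F0].
  rewrite (ge0_integral_affine 0 _ mF F0) ?oppr_eq0// normrN muleA -EFinM.
  by rewrite -invfM -expr2 real_normK ?num_real// a0 expr0n add0r.
(* Taking the first image coordinate as the new [x] turns the second one into
   [k * y + b / a * x]. *)
pose k := ((a ^+ 2 + b ^+ 2) / a)%R.
have k0 : k != 0%R by rewrite mulf_neq0 ?invr_eq0// gt_eqF.
pose h (x : R * R) := f (x.1, k * x.2 + b / a * x.1)%R.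
have h0 x : 0 <= h x by exact: f0.
have mh : measurable_fun setT h.
  have mg : measurable_fun setT (fun x : R * R =>
      (x.1, k * x.2 + b / a * x.1)%R).
    apply/measurable_fun_pairP; split; first exact: measurable_fst.
    by apply: measurable_funD; apply: measurable_funM.
  exact: (measurableT_comp mf mg).
have mhG := measurable_integral2 mh h0.
transitivity (\int[mu]_y ((`|a|^-1)%:E * \int[mu]_x h (x, y))).
  apply: eq_integral => y _.
  rewrite -(ge0_integral_affine (- (b * y)) a0)//; last first.
    exact: measurableT_comp (pair2_measurable y).
  by apply: eq_integral => x _; rewrite /h/=; congr (f (_, _));
    rewrite /k; field.
have hG0 y : 0 <= \int[mu]_x h (x, y) by exact: integral_ge0.
rewrite (integralZ _ mhG hG0) ?invr_ge0// -(tonelli2 mh h0) (tonelli1 mh h0).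
transitivity ((`|a|^-1)%:E * \int[mu]_x ((`|k|^-1)%:E * F x)).
  congr (_ * _); apply: eq_integral => x _.
  by rewrite -(ge0_integral_affine (b / a * x) k0).
rewrite (integralZ _ mF F0) ?invr_ge0// muleA -EFinM -invfM -normrM /k.
by rewrite mulrCA divff// mulr1 gtr0_norm.
Qed.

End change_of_variables.

(** * Averages over a family of conformal maps *)

Section averaging.
Context {R : realType}.
Local Notation mu := (@lebesgue_measure R).
Local Open Scope ereal_scope.

(** After Tonelli's theorem the inner integral is a conformal substitution, whose factor cancels the
    Jacobian [a t ^+ 2 + b t ^+ 2] of the hypothesis; only the mass of [k] over [D] is left. *)
Lemma le_integral_conformal_average (D : set R) (k a b : R -> R)
    (F G : R * R -> R) :
  measurable D -> measurable_fun setT k ->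
  measurable_fun setT a -> measurable_fun setT b ->
  measurable_fun setT F -> measurable_fun setT G ->
  (forall t, 0 <= k t)%R -> (forall t, 0 < a t ^+ 2 + b t ^+ 2)%R ->
  (forall x, 0 <= F x)%R -> (forall x, 0 <= G x)%R ->
  (forall x, (F x)%:E <= \int[mu]_(t in D)
     (k t * (a t ^+ 2 + b t ^+ 2) *
      G (a t * x.1 - b t * x.2, b t * x.1 + a t * x.2)%R)%:E) ->
  \int[leb2]_x (F x)%:E <=
    \int[mu]_(t in D) (k t)%:E * \int[leb2]_x (G x)%:E.
Proof.
move=> mD mk ma mb mF mG k0 ab0 F0 G0 FG.
pose h (z : (R * R) * R) : R := (k z.2 * \1_D z.2 * (a z.2 ^+ 2 + b z.2 ^+ 2) *
  G (a z.2 * z.1.1 - b z.2 * z.1.2, b z.2 * z.1.1 + a z.2 * z.1.2))%R.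
have h0 z : (0 <= h z)%R by rewrite /h !mulr_ge0// ltW.
have mcomp2 (g : R -> R) : measurable_fun setT g ->
    measurable_fun setT (fun z : (R * R) * R => g z.2).
  by move=> mg; exact: (measurableT_comp mg measurable_snd).
have mfst1 : measurable_fun setT (fun z : (R * R) * R => z.1.1).
  exact: (measurableT_comp measurable_fst measurable_fst).
have mfst2 : measurable_fun setT (fun z : (R * R) * R => z.1.2).
  exact: (measurableT_comp measurable_snd measurable_fst).
have mh : measurable_fun setT h.
  apply: measurable_funM.
    apply: measurable_funM.
      by apply: measurable_funM; apply: mcomp2 => //; exact: measurable_indic.
    by apply: measurable_funD; apply: measurable_funX; exact: mcomp2.
  have mM : measurable_fun setT (fun z : (R * R) * R =>
      (a z.2 * z.1.1 - b z.2 * z.1.2, b z.2 * z.1.1 + a z.2 * z.1.2)%R).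
    apply/measurable_fun_pairP; split.
      by apply: measurable_funB; apply: measurable_funM => //; exact: mcomp2.
    by apply: measurable_funD; apply: measurable_funM => //; exact: mcomp2.
  exact: (measurableT_comp mG mM).
have mEG : measurable_fun setT (fun x : R * R => (G x)%:E).
  exact/measurable_EFinP.
have mEh : measurable_fun setT (EFin \o h) by exact/measurable_EFinP.
have hD x : \int[mu]_(t in D)
     (k t * (a t ^+ 2 + b t ^+ 2) *
      G (a t * x.1 - b t * x.2, b t * x.1 + a t * x.2)%R)%:E =
     \int[mu]_t (h (x, t))%:E.
  rewrite integral_mkcond; apply: eq_integral => t _.
  rewrite patchE /h/= indicE.
  by case: (t \in D); rewrite ?mulr1// mulr0 !mul0r.
have swap : \int[leb2]_x \int[mu]_t (h (x, t))%:E =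
    \int[mu]_t \int[leb2]_x (h (x, t))%:E.
  exact: (@fubini_tonelli _ _ (measurableTypeR R * measurableTypeR R)%type
    (measurableTypeR R) _ (@leb2 R) mu (EFin \o h) mEh h0).
have mhD : measurable_fun setT (fun x => \int[mu]_t (h (x, t))%:E).
  exact: (@measurable_fun_fubini_tonelli_F _ _
    (measurableTypeR R * measurableTypeR R)%type (measurableTypeR R) _
    mu (EFin \o h) mEh).
apply: (@le_trans _ _ (\int[leb2]_x \int[mu]_t (h (x, t))%:E)).
  apply: ge0_le_integral => //.
  - by move=> x _; rewrite lee_fin.
  - exact/measurable_EFinP.
  - by move=> x _; rewrite -hD.
have mkD : measurable_fun setT (fun t => k t * \1_D t)%R.
  by apply: measurable_funM => //; exact: measurable_indic.
rewrite swap.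
rewrite [X in _ <= X * _](_ : _ = \int[mu]_t (k t * \1_D t)%:E); last first.
  rewrite integral_mkcond; apply: eq_integral => t _.
  by rewrite patchE indicE; case: (t \in D); rewrite ?mulr1// mulr0.
rewrite -ge0_integralZr//; last 3 first.
- exact/measurable_EFinP.
- by move=> t _; rewrite lee_fin mulr_ge0.
- by apply: integral_ge0 => x _; rewrite lee_fin.
rewrite le_eqVlt; apply/orP; left; apply/eqP; apply: eq_integral => t _.
pose c := (k t * \1_D t * (a t ^+ 2 + b t ^+ 2))%R.
have c0 : (0 <= c)%R by rewrite !mulr_ge0// ltW.
have mGt : measurable_fun setT (fun x : R * R =>
    (G (a t * x.1 - b t * x.2, b t * x.1 + a t * x.2)%R)%:E).
  apply/measurable_EFinP; apply: (measurableT_comp mG).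
  apply/measurable_fun_pairP; split.
    by apply: measurable_funB; apply: measurable_funM.
  by apply: measurable_funD; apply: measurable_funM.
transitivity (c%:E * \int[leb2]_x
    (G (a t * x.1 - b t * x.2, b t * x.1 + a t * x.2)%R)%:E).
  rewrite -ge0_integralZl//.
  by move=> x _; rewrite lee_fin.
rewrite (@ge0_integral_conformal _ (a t) (b t) (fun x => (G x)%:E))//.
by rewrite muleA -EFinM /c mulfK// gt_eqF.
Qed.

End averaging.

(** * Increments and a tangent-line inequality *)

Section one_variable.
Context {R : realType}.
Local Notation mu := (@lebesgue_measure R).

(** The fundamental theorem of calculus expresses the increment through [h]; [z] dominates the
    positive part of [h], and its integral may be infinite. *)
Lemma le_increment_integral (H h z : R -> R) (a b : R) : a < b ->
  (forall t : R, is_derive t (1 : R) H (h t)) -> continuous h ->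
  measurable_fun setT z -> (forall t, h t <= z t) -> (forall t, 0 <= z t) ->
  ((H b - H a)%:E <= \int[mu]_(t in `[a, b]) (z t)%:E)%E.
Proof.
move=> ab dH ch mz hz z0.
have dvH t : derivable H t 1 by have [] := dH t.
have cH : continuous H.
  by move=> t; apply/differentiable_continuous/derivable1_diffP.
have mh : measurable_fun setT h by exact: continuous_measurable_fun.
rewrite EFinB -(@continuous_FTC2 R h H)//; first last.
- by move=> t _; rewrite derive1E; have [_ ->] := dH t.
- split=> [t _||]; first exact: dvH.
  + by apply: cvg_at_right_filter; exact: cH.
  + by apply: cvg_at_left_filter; exact: cH.
- exact: continuous_subspaceT.
rewrite integralE; apply: (@le_trans _ _
    (\int[mu]_(t in `[a, b]) ((fun t => (h t)%:E)^\+ t))%E).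
  by rewrite -[leRHS]sube0 leeB//; apply: integral_ge0.
apply: ge0_le_integral => //.
- have mhE : measurable_fun `[a, b]%classic (fun t => (h t)%:E).
    by apply/measurable_EFinP; exact: measurable_funTS.
  exact: (measurable_funepos mhE).
- by apply/measurable_EFinP; exact: measurable_funTS.
- by move=> t _; rewrite funeposE -EFin_max lee_fin ge_max hz z0.
Qed.

(** Young's inequality for y/k and m^(p-1) with exponents p and p/(p-1), multiplied by p k. The
    left-hand side is the tangent line, at y = m k, of the right-hand side as a function of [y]. *)
Lemma powR_tangent (p y k m : R) : 1 < p -> 0 <= y -> 0 < k -> 0 < m ->
  p * m `^ (p - 1) * y - (p - 1) * m `^ p * k <= y `^ p * k `^ (1 - p).
Proof.
move=> p1 y0 k0 m0.
have p0 : 0 < p by lra.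
have p1_neq0 : p - 1 != 0 by rewrite subr_eq0 gt_eqF.
have q0 : 0 < p / (p - 1) by rewrite divr_gt0// subr_gt0.
have pq : p^-1 + (p / (p - 1))^-1 = 1 by field; rewrite p1_neq0 gt_eqF.
have := conjugate_powR (divr_ge0 y0 (ltW k0)) (powR_ge0 m (p - 1)) p0 q0 pq.
have -> : (m `^ (p - 1)) `^ (p / (p - 1)) = m `^ p.
  by rewrite -powRrM mulrCA divff ?mulr1.
rewrite powRM ?invr_ge0 ?(ltW k0)//.
have -> : k^-1 `^ p = k `^ (1 - p) / k.
  rewrite -powR_inv1 ?(ltW k0)// -powRrM mulN1r powRD; last first.
    by rewrite (gt_eqF k0) implybT.
  rewrite powR_inv1 ?(ltW k0)// powRr1 ?(ltW k0)//.
  by rewrite mulrAC divff ?mul1r// gt_eqF.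
rewrite -(ler_pM2l (mulr_gt0 p0 k0)).
rewrite lerBlDr; congr (_ <= _).
  by field; rewrite gt_eqF.
by field; rewrite p1_neq0 !gt_eqF.
Qed.

End one_variable.

(** * Chain rule along a plane curve *)

Section curves.
Context {R : realType}.
Implicit Types f : R * R -> R.

Lemma is_derive_line1 f s c : derivable f (s, c) basis1 ->
  is_derive s (1 : R) (fun r => f (r, c)) ('D_basis1 f (s, c)).
Proof.
rewrite /derivable => df.
have E : (fun h : R => h^-1 *: (((fun r => f (r, c)) \o shift s) (h *: (1 : R))
            - f (s, c))) =
    (fun h : R => h^-1 *: ((f \o shift (s, c)) (h *: basis1) - f (s, c))).
  apply/funext => h /=; congr (_ *: (f _ - _)).
  by apply: injective_projections; rewrite /= ?scaler0 ?add0r.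
by split; [rewrite /derivable E|rewrite /derive E].
Qed.

Lemma is_derive_line2 f s c : derivable f (c, s) basis2 ->
  is_derive s (1 : R) (fun r => f (c, r)) ('D_basis2 f (c, s)).
Proof.
rewrite /derivable => df.
have E : (fun h : R => h^-1 *: (((fun r => f (c, r)) \o shift s) (h *: (1 : R))
            - f (c, s))) =
    (fun h : R => h^-1 *: ((f \o shift (c, s)) (h *: basis2) - f (c, s))).
  apply/funext => h /=; congr (_ *: (f _ - _)).
  by apply: injective_projections; rewrite /= ?scaler0 ?add0r.
by split; [rewrite /derivable E|rewrite /derive E].
Qed.

(** Locating [c] by its distance to [a] covers both orders of [a] and [b], and lets [c] be squeezed
    as [b] tends to [a]. *)
Lemma MVT_dist (f df : R -> R) (a b : R) :
  (forall x : R, is_derive x (1 : R) f (df x)) ->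
  exists c, `|c - a| <= `|b - a| /\ f b - f a = df c * (b - a).
Proof.
move=> dvf.
have cf : continuous f.
  move=> x; apply/differentiable_continuous/derivable1_diffP.
  by have [] := dvf x.
have [ab|/ltW ba] := leP a b.
  have [c] := MVT_segment ab (fun x _ => dvf x) (continuous_subspaceT cf).
  rewrite in_itv/= => /andP[ac cb] fE; exists c; split=> //.
  by rewrite !ger0_norm ?subr_ge0// lerD2r.
have [c] := MVT_segment ba (fun x _ => dvf x) (continuous_subspaceT cf).
rewrite in_itv/= => /andP[bc ca] fE; exists c; split=> //.
  by rewrite !ler0_norm ?subr_le0// lerN2 lerD2r.
by rewrite -opprB fE -mulrN opprB.
Qed.

(** The increment is cut into a horizontal and a vertical part; the mean value theorem gives on each
    a partial derivative at an intermediate point, and continuity of the partials passes to the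
    limit. *)
Lemma is_derive_curve f (g1 g2 : R -> R) (t d1 d2 : R) : of_class_C 1 f ->
  is_derive t (1 : R) g1 d1 -> is_derive t (1 : R) g2 d2 ->
  is_derive t (1 : R) (fun s => f (g1 s, g2 s))
    ('D_basis1 f (g1 t, g2 t) * d1 + 'D_basis2 f (g1 t, g2 t) * d2).
Proof.
move=> [_ df cf1 cf2] dg1 dg2.
have cvg_quot (g : R -> R) d : is_derive t (1 : R) g d ->
    h^-1 *: (g (h *: (1 : R) + t) - g t) @[h --> 0^'] --> d.
  by move=> [dg <-]; exact: dg.
have cvg_incr (g : R -> R) d : is_derive t (1 : R) g d ->
    g (h *: (1 : R) + t) @[h --> 0^'] --> g t.
  move=> [dg _].
  have cg : {for t, continuous g}.
    by apply/differentiable_continuous/derivable1_diffP.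
  have h0 : h *: (1 : R) + t @[h --> 0^'] --> 0 *: (1 : R) + t.
    by apply: cvgD; [apply: cvgZr_tmp; exact: cvg_within|exact: cvg_cst].
  by rewrite scale0r add0r in h0; exact: cvg_comp h0 cg.
pose tau (h : R) : R := h *: (1 : R) + t.
have /choice[xi xiP] (h : R) : exists c,
    `|c - g1 t| <= `|g1 (tau h) - g1 t| /\
    f (g1 (tau h), g2 (tau h)) -
      f (g1 t, g2 (tau h)) =
    'D_basis1 f (c, g2 (tau h)) * (g1 (tau h) - g1 t).
  apply: (MVT_dist (f := fun r => f (r, g2 (tau h)))) => x.
  by apply: is_derive_line1; exact: (df _).1.
have /choice[eta etaP] (h : R) : exists c,
    `|c - g2 t| <= `|g2 (tau h) - g2 t| /\
    f (g1 t, g2 (tau h)) - f (g1 t, g2 t) =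
    'D_basis2 f (g1 t, c) * (g2 (tau h) - g2 t).
  apply: (MVT_dist (f := fun r => f (g1 t, r))) => x.
  by apply: is_derive_line2; exact: (df _).2.
(* The mean value points are no farther from their limit than the curve is, and so converge with
   it. *)
have squeeze (u v : R -> R) l : (forall h, `|u h - l| <= `|v h - l|) ->
    v h @[h --> 0^'] --> l -> u h @[h --> 0^'] --> l.
  move=> uv /cvgrPdist_le vl; apply/cvgrPdist_le => e e0.
  apply: filterS (vl e e0) => h; rewrite distrC => vle.
  by rewrite distrC (le_trans (uv h)).
have xil : xi h @[h --> 0^'] --> g1 t.
  by apply: (squeeze _ _ _ (fun h => (xiP h).1)); exact: cvg_incr dg1.
have etal : eta h @[h --> 0^'] --> g2 t.
  by apply: (squeeze _ _ _ (fun h => (etaP h).1)); exact: cvg_incr dg2.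
have L1 : 'D_basis1 f (xi h, g2 (tau h)) @[h --> 0^'] -->
    'D_basis1 f (g1 t, g2 t).
  apply: (@cvg_comp _ _ _ (fun h => (xi h, g2 (tau h))) ('D_basis1 f)
    _ _ _ _ (cf1 (g1 t, g2 t))).
  exact: (cvg_pair xil (cvg_incr _ _ dg2)).
have L2 : 'D_basis2 f (g1 t, eta h) @[h --> 0^'] --> 'D_basis2 f (g1 t, g2 t).
  apply: (@cvg_comp _ _ _ (fun h => (g1 t, eta h)) ('D_basis2 f)
    _ _ _ _ (cf2 (g1 t, g2 t))).
  exact: (cvg_pair (cvg_cst _) etal).
have L : h^-1 *: (f (g1 (tau h), g2 (tau h)) - f (g1 t, g2 t))
    @[h --> 0^'] -->
    'D_basis1 f (g1 t, g2 t) * d1 + 'D_basis2 f (g1 t, g2 t) * d2.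
  rewrite (_ : (fun h : R => _) = (fun h =>
    'D_basis1 f (xi h, g2 (tau h)) * (h^-1 *: (g1 (tau h) - g1 t)) +
    'D_basis2 f (g1 t, eta h) * (h^-1 *: (g2 (tau h) - g2 t)))).
    exact: (cvgD (cvgM L1 (cvg_quot _ _ dg1)) (cvgM L2 (cvg_quot _ _ dg2))).
  apply/funext => h.
  rewrite -[in LHS](subrKA (f (g1 t, g2 (tau h)))) (xiP h).2 (etaP h).2.
  by rewrite scalerDr !scalerAr.
split; first by apply/cvg_ex; eexists; exact: L.
by apply: cvg_lim => //; exact: L.
Qed.

End curves.

(** * Euclidean norm and Jensen's inequality for displacements *)

Section planar_norm.
Context {R : realType}.

Lemma norm2_ge0 (x : R * R) : 0 <= norm2 x.
Proof. exact: sqrtr_ge0. Qed.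

Lemma sqr_norm2 (x : R * R) : norm2 x ^+ 2 = x.1 ^+ 2 + x.2 ^+ 2.
Proof. by rewrite /norm2 sqr_sqrtr// addr_ge0// sqr_ge0. Qed.

(** Cauchy-Schwarz from Lagrange's identity: the squares differ by (x_1 y_2 - x_2 y_1)^2. *)
Lemma dot_le_norm2 (x y : R * R) :
  x.1 * y.1 + x.2 * y.2 <= norm2 x * norm2 y.
Proof.
apply: (le_trans (ler_norm _)).
rewrite -(ler_pXn2r (n := 2)) ?nnegrE ?mulr_ge0 ?norm2_ge0//.
rewrite real_normK ?num_real// exprMn !sqr_norm2 -subr_ge0.
rewrite (_ : _ - _ = (x.1 * y.2 - x.2 * y.1) ^+ 2) ?sqr_ge0//.
by ring.
Qed.

Lemma measurable_norm2 d (T : measurableType d) (f g : T -> R) :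
  measurable_fun setT f -> measurable_fun setT g ->
  measurable_fun setT (fun x => norm2 (f x, g x)).
Proof.
move=> mf mg; have ms : measurable_fun setT (@Num.sqrt R).
  by apply: continuous_measurable_fun; exact: sqrt_continuous.
apply: (measurableT_comp ms).
by apply: measurable_funD; exact: measurable_funX.
Qed.

Lemma measurable_powR_fun d (T : measurableType d) (f : T -> R) (p : R) :
  measurable_fun setT f -> measurable_fun setT (fun x => f x `^ p).
Proof. by move=> mf; exact: (measurableT_comp (measurable_powR p) mf). Qed.

(* Jensen's inequality for the weight k on |V b - V a| <= int |v|. Integrating
   its tangent line, instead of applying Jensen to |v|, needs only the
   fundamental theorem for the scalar component of V along V b - V a. *)
Lemma displacement_powR_le (p a b : R) (V1 V2 v1 v2 K k : R -> R) :
  1 < p -> a < b ->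
  (forall t : R, is_derive t (1 : R) V1 (v1 t)) ->
  (forall t : R, is_derive t (1 : R) V2 (v2 t)) ->
  (forall t : R, is_derive t (1 : R) K (k t)) ->
  continuous v1 -> continuous v2 -> continuous k ->
  (forall t, 0 < k t) -> K b - K a <= 1 ->
  ((norm2 (V1 b - V1 a, V2 b - V2 a) `^ p)%:E <=
   \int[lebesgue_measure]_(t in `[a, b])
     (norm2 (v1 t, v2 t) `^ p * k t `^ (1 - p))%:E)%E.
Proof.
move=> p1 ab dV1 dV2 dK cv1 cv2 ck k0 Kab.
set w1 := V1 b - V1 a; set w2 := V2 b - V2 a.
set m := norm2 (w1, w2).
have mm : m ^+ 2 = w1 ^+ 2 + w2 ^+ 2 by rewrite /m sqr_norm2.
have p0 : p != 0 by rewrite gt_eqF//; lra.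
have z0 t : 0 <= norm2 (v1 t, v2 t) `^ p * k t `^ (1 - p).
  by rewrite mulr_ge0 ?powR_ge0.
have [m0|m0] := eqVneq m 0.
  by rewrite m0 powR0//; apply: integral_ge0 => t _; rewrite lee_fin.
have {}m0 : 0 < m by rewrite lt_neqAle eq_sym m0 norm2_ge0.
have m1 : m * m `^ (p - 1) = m `^ p by apply: mulr_powRB1; [exact: ltW|lra].
(* In the bound of [powR_tangent], |v| is replaced by its component along the unit vector (w1,
   w2)/m; [c] and [d] are the resulting coefficients, and [H] is a primitive. *)
set c := p * m `^ (p - 1) / m; set d := (p - 1) * m `^ p.
have d0 : 0 <= d by rewrite mulr_ge0 ?powR_ge0//; lra.
have c0 : 0 <= c by rewrite divr_ge0 ?mulr_ge0 ?powR_ge0 ?(ltW m0)//; lra.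
pose H t := c * (w1 * V1 t + w2 * V2 t) - d * K t.
pose h t := c * (w1 * v1 t + w2 * v2 t) - d * k t.
have dH t : is_derive t (1 : R) H (h t).
  have dw1 := dV1 t; have dw2 := dV2 t; have dw3 := dK t.
  rewrite /H /h; apply: is_derive_eq.
  by rewrite /GRing.scale/=; ring.
have ch : continuous h.
  move=> t; apply: cvgB; apply: cvgM; try exact: cvg_cst; last exact: ck.
  by apply: cvgD; apply: cvgM; try exact: cvg_cst; [exact: cv1|exact: cv2].
apply: le_trans (le_increment_integral ab dH ch _ _ z0).
- rewrite lee_fin /H.
  (* The increment of [H] is p m^p - (p-1) m^p (K b - K a), at least m^p because
     [K b - K a <= 1]. *)
  have -> : c * (w1 * V1 b + w2 * V2 b) - d * K b -
      (c * (w1 * V1 a + w2 * V2 a) - d * K a) =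
      c * (w1 ^+ 2 + w2 ^+ 2) - d * (K b - K a) by rewrite /w1 /w2; ring.
  rewrite -mm (_ : c * m ^+ 2 = p * m `^ p); last first.
    by rewrite -m1 /c; field; rewrite gt_eqF.
  have : d * (K b - K a) <= d by rewrite ler_piMr.
  rewrite /d; lra.
- apply: measurable_funM; apply: measurable_powR_fun.
    by apply: measurable_norm2; exact: continuous_measurable_fun.
  exact: continuous_measurable_fun.
- move=> t.
  apply: le_trans (powR_tangent p1 (norm2_ge0 (v1 t, v2 t)) (k0 t) m0).
  rewrite /h lerB//.
  have -> : p * m `^ (p - 1) * norm2 (v1 t, v2 t) =
      c * (m * norm2 (v1 t, v2 t)) by rewrite /c; field; rewrite gt_eqF.
  exact: ler_wpM2l (dot_le_norm2 (w1, w2) (v1 t, v2 t)).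
Qed.

End planar_norm.

(** * Dilations, rotations and their generators *)

Section test_functions.
Context {R : realType}.
Implicit Types f g : R * R -> R.

Definition radial_derivative f (x : R * R) : R :=
  x.1 * 'D_basis1 f x + x.2 * 'D_basis2 f x.

Definition angular_derivative f (x : R * R) : R :=
  x.1 * 'D_basis2 f x - x.2 * 'D_basis1 f x.

Lemma continuous_radial_derivative f :
  of_class_C 1 f -> continuous (radial_derivative f).
Proof.
move=> [_ _ c1 c2] x; apply: cvgD; apply: cvgM; [|exact: c1| |exact: c2].
  exact: cvg_fst.
exact: cvg_snd.
Qed.

Lemma continuous_angular_derivative f :
  of_class_C 1 f -> continuous (angular_derivative f).
Proof.
move=> [_ _ c1 c2] x; apply: cvgB; apply: cvgM; [|exact: c2| |exact: c1].
  exact: cvg_fst.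
exact: cvg_snd.
Qed.

Lemma continuous_along f (g1 g2 : R -> R) :
  continuous f -> continuous g1 -> continuous g2 ->
  continuous (fun t => f (g1 t, g2 t)).
Proof.
move=> cf cg1 cg2 t.
exact: (cvg_comp _ _ (cvg_pair (cg1 t) (cg2 t)) (cf (g1 t, g2 t))).
Qed.

Lemma is_derive_dilation f (x : R * R) (t : R) : of_class_C 1 f ->
  is_derive t (1 : R) (fun s => f (expR s * x.1, expR s * x.2))
    (radial_derivative f (expR t * x.1, expR t * x.2)).
Proof.
move=> cf.
have de (a : R) : is_derive t (1 : R) (fun s => expR s * a) (expR t * a).
  by apply: is_derive_eq; rewrite /GRing.scale/=; ring.
apply: is_derive_eq; first exact: (is_derive_curve cf (de x.1) (de x.2)).
by rewrite /radial_derivative/=; ring.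
Qed.

Definition rotation (t : R) (x : R * R) : R * R :=
  (cos t * x.1 - sin t * x.2, sin t * x.1 + cos t * x.2).

Lemma is_derive_rotation f (x : R * R) (t : R) : of_class_C 1 f ->
  is_derive t (1 : R) (fun s => f (rotation s x))
    (angular_derivative f (rotation t x)).
Proof.
move=> cf.
have d1 : is_derive t (1 : R) (fun s => cos s * x.1 - sin s * x.2)
    (- (sin t * x.1 + cos t * x.2)).
  by apply: is_derive_eq; rewrite /GRing.scale/=; ring.
have d2 : is_derive t (1 : R) (fun s => sin s * x.1 + cos s * x.2)
    (cos t * x.1 - sin t * x.2).
  by apply: is_derive_eq; rewrite /GRing.scale/=; ring.
apply: is_derive_eq; first exact: (is_derive_curve cf d1 d2).
by rewrite /angular_derivative/=; ring.
Qed.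

Lemma norm2_dilation (r : R) (x : R * R) : 0 <= r ->
  norm2 (r * x.1, r * x.2) = r * norm2 x.
Proof.
move=> r0; rewrite /norm2/= !exprMn -mulrDr sqrtrM ?sqr_ge0//.
by rewrite sqrtr_sqr ger0_norm.
Qed.

Lemma norm2_rotation (t : R) (x : R * R) : norm2 (rotation t x) = norm2 x.
Proof.
rewrite /norm2 /rotation/=; congr Num.sqrt.
have /(congr1 (fun z => z * (x.1 ^+ 2 + x.2 ^+ 2))) := cos2Dsin2 t.
by rewrite mul1r => <-; ring.
Qed.

End test_functions.

(** * Radial and angular Hardy inequalities *)

Section hardy.
Context {R : realType}.
Local Notation mu := (@lebesgue_measure R).
Implicit Types f g : R * R -> R.

Lemma measurable_weighted (p : R) (v1 v2 : R * R -> R) :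
  continuous v1 -> continuous v2 ->
  measurable_fun setT
    (fun x : R * R => norm2 (v1 x, v2 x) `^ p * norm2 x `^ (- p)).
Proof.
move=> c1 c2; apply: measurable_funM; apply: measurable_powR_fun.
  by apply: measurable_norm2; exact: continuous_measurable_prod.
rewrite (_ : norm2 = fun x : R * R => norm2 (x.1, x.2)); last first.
  by apply/funext => -[].
by apply: measurable_norm2; [exact: measurable_fst|exact: measurable_snd].
Qed.

Lemma continuous_expR_scale (a : R) : continuous (fun t => expR (a * t)).
Proof.
by move=> t; apply: continuous_comp;
  [exact: mulrl_continuous|exact: continuous_expR].
Qed.

(** Since [c * p = 2 - p], the exponents -ct + 2t - pt (density, Jacobian, Hardy weight) and
    -ct(1-p) agree, so the averaging kernel becomes the Jensen weight with exponent [1 - p]. *)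
Let exponential_weight (c p t n e : R) : 0 < c -> 0 <= n -> c * p = 2 - p ->
  c `^ (- p) * (c * expR (- c * t)) * (expR t ^+ 2 + 0 ^+ 2) *
    (e * (expR t * n) `^ (- p)) =
  n `^ (- p) * (e * (c * expR (- c * t)) `^ (1 - p)).
Proof.
move=> c0 n0 cp.
rewrite !powRM ?expR_ge0 ?(ltW c0)// -!expRM -expRM_natr.
have -> : c `^ (1 - p) = c * c `^ (- p).
  by rewrite powRD ?powRr1 ?(ltW c0)// (gt_eqF c0) implybT.
have -> : expR (- c * t * (1 - p)) =
    expR (- c * t) * expR (t * 2) * expR (t * - p).
  rewrite -!expRD; congr expR.
  have /(congr1 (fun z => z * t)) := cp; lra.
ring.
Qed.

(* u(x) is minus the increment of u along t |-> u(e^t x) on [0, +oo[; the weight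
   c e^(-ct) with c = (2-p)/p balances the Jacobian e^(2t) of the dilation, and
   makes the constant sharp. *)
Lemma radial_hardy (p : R) f g : 1 < p -> p < 2 ->
  of_class_C 1 f -> of_class_C 1 g ->
  (exists M, forall x, M < norm2 x -> f x = 0 /\ g x = 0) ->
  (\int[leb2]_x (norm2 (f x, g x) `^ p * norm2 x `^ (- p))%:E <=
   (((2 - p) / p) `^ (- p))%:E *
   \int[leb2]_x (norm2 (radial_derivative f x, radial_derivative g x) `^ p *
     norm2 x `^ (- p))%:E)%E.
Proof.
move=> p1 p2 Cf Cg [M fgM].
set c := (2 - p) / p.
have p0 : 0 < p by lra.
have c0 : 0 < c by rewrite divr_gt0// subr_gt0.
have cp : c * p = 2 - p by rewrite /c divfK// gt_eqF.
have [[cf _ _ _] [cg _ _ _]] := (Cf, Cg).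
have cRf := continuous_radial_derivative Cf.
have cRg := continuous_radial_derivative Cg.
pose k t := c `^ (- p) * exponential_pdf c t.
have mpdf := measurable_exponential_pdf c.
have pdf0 t : 0 <= exponential_pdf c t.
  by apply: exponential_pdf_ge0; exact: ltW.
(* The exponential density has mass 1, so the Hardy constant is the mass of [k]. *)
have int_k : ((c `^ (- p))%:E = \int[mu]_(t in `[0%R, +oo[) (k t)%:E)%E.
  under eq_integral do rewrite /k EFinM.
  rewrite ge0_integralZl//; last 3 first.
  - by apply/measurable_EFinP; exact: measurable_funTS.
  - by move=> t _; rewrite lee_fin.
  - by rewrite lee_fin powR_ge0.
  rewrite -[LHS]mule1 -(integral_exponential_pdf c0); congr (_ * _)%E.
  rewrite [RHS]integral_mkcond; apply: eq_integral => t _.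
  by rewrite patchE /exponential_pdf patchE; case: ifP.
rewrite int_k.
apply: (@le_integral_conformal_average _ _ _ expR (cst 0)) => //.
- exact: measurable_funM.
- exact: measurable_weighted.
- exact: measurable_weighted.
- by move=> t; rewrite mulr_ge0 ?powR_ge0.
- by move=> t; rewrite expr0n addr0 exprn_gt0// expR_gt0.
- by move=> x; rewrite mulr_ge0 ?powR_ge0.
- by move=> x; rewrite mulr_ge0 ?powR_ge0.
move=> x.
pose z t := norm2 (radial_derivative f (expR t * x.1, expR t * x.2),
    radial_derivative g (expR t * x.1, expR t * x.2)) `^ p *
    (c * expR (- c * t)) `^ (1 - p).
have cdil (v : R * R -> R) : continuous v ->
    continuous (fun t => v (expR t * x.1, expR t * x.2)).
  by move=> cv; apply: continuous_along => // t; apply: cvgM;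
    by [exact: continuous_expR|exact: cvg_cst].
have ck : continuous (fun t => c * expR (- c * t)).
  by move=> t; apply: cvgM; [exact: cvg_cst|exact: continuous_expR_scale].
have z0 t : 0 <= z t by rewrite mulr_ge0 ?powR_ge0.
have mz : measurable_fun setT z.
  apply: measurable_funM; apply: measurable_powR_fun.
    by apply: measurable_norm2; apply: continuous_measurable_fun; exact: cdil.
  exact: continuous_measurable_fun.
rewrite [leRHS](_ : _ =
    \int[mu]_(t in `[0%R, +oo[) ((norm2 x `^ (- p))%:E * (z t)%:E))%E;
  last first.
  apply: eq_integral => t; rewrite inE/= in_itv/= andbT => t0.
  rewrite -EFinM; congr EFin.
  rewrite !mul0r subr0 add0r norm2_dilation ?expR_ge0// /k exponential_pdfE//.
  by apply: exponential_weight => //; exact: norm2_ge0.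
rewrite ge0_integralZl//; last 3 first.
- by apply/measurable_EFinP; exact: measurable_funTS.
- by move=> t _; rewrite lee_fin.
- by rewrite lee_fin powR_ge0.
rewrite mulrC EFinM.
(* Zero to a nonzero power is 0, even a negative one, so both sides vanish at the origin. *)
have [x0|x0] := eqVneq (norm2 x) 0.
  by rewrite x0 powR0 ?oppr_eq0 ?gt_eqF// !mul0e.
have {}x0 : 0 < norm2 x by rewrite lt_neqAle eq_sym x0 norm2_ge0.
apply: lee_wpmul2l; first by rewrite lee_fin powR_ge0.
(* As e^L >= 1 + L > M/|x|, the point e^L x lies where u vanishes, and the increment over [0, L] is
   -u(x). *)
pose L := `|M| / norm2 x + 1.
have L0 : 0 < L by rewrite ltr_wpDl// divr_ge0// ltW.
have [fL gL] :
    f (expR L * x.1, expR L * x.2) = 0 /\ g (expR L * x.1, expR L * x.2) = 0.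
  apply: fgM; rewrite norm2_dilation ?expR_ge0// -ltr_pdivrMr//.
  apply: (lt_le_trans _ (expR_ge1Dx L)).
  have : M / norm2 x <= `|M| / norm2 x by rewrite ler_pM2r ?invr_gt0// ler_norm.
  rewrite /L; lra.
apply: (@le_trans _ _ (\int[mu]_(t in `[0%R, L]) (z t)%:E)%E); last first.
  apply: ge0_subset_integral => //.
  - by apply/measurable_EFinP; exact: measurable_funTS.
  - by move=> t _; rewrite lee_fin.
  - by move=> t /=; rewrite !in_itv/= => /andP[->].
(* The primitive -e^(-ct) of the weight grows by 1 - e^(-cL) <= 1 on [0, L]. *)
have := @displacement_powR_le _ p 0 L _ _ _ _ (fun t => - expR (- c * t)) _
  p1 L0
  (fun t => is_derive_dilation x t Cf) (fun t => is_derive_dilation x t Cg)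
  _ (cdil _ cRf) (cdil _ cRg) ck.
rewrite fL gL expR0 !mul1r !sub0r -surjective_pairing.
have -> : norm2 (- f x, - g x) = norm2 (f x, g x) by rewrite /norm2/= !sqrrN.
apply.
- move=> t; apply: is_derive_eq; rewrite /GRing.scale/=; ring.
- by move=> t; rewrite mulr_gt0// expR_gt0.
- by rewrite mulr0 expR0; have := expR_ge0 (- c * L); lra.
Qed.

(** With [r] the fractional part of [beta], periodicity gives cos(2 pi beta) = 1 - 2 sin(pi r)^2,
    and 0 < pi r < pi. *)
Lemma cos_lt1_nonint (beta : R) : beta \isn't a Num.int ->
  cos (pi *+ 2 * beta) < 1.
Proof.
move=> nint; pose n := Num.floor beta; pose r := beta - n%:~R.
have r01 : 0 < r < 1.
  rewrite subr_gt0 lt_neqAle -intrEfloor nint/= floor_le/=.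
  by rewrite ltrBlDr addrC -intrD1 floorD1_gt.
have -> : cos (pi *+ 2 * beta) = cos ((pi * r) *+ 2).
  have -> : (pi * r) *+ 2 = pi *+ 2 * beta - pi *+ 2 * n%:~R.
    by rewrite /r; ring.
  case: (n) => m.
    rewrite -[in LHS](subrK (pi *+ 2 * (Posz m)%:~R) (pi *+ 2 * beta)).
    by rewrite -[_%:~R]/(m%:R) mulr_natr (periodicn (@cosD2pi R)).
  rewrite NegzE mulrNz mulrN opprK -[_%:~R]/(m.+1%:R) mulr_natr.
  by rewrite (periodicn (@cosD2pi R)).
have s0 : 0 < sin (pi * r).
  case/andP: r01 => r0 r1; apply: sin_gt0_pi.
  by rewrite mulr_gt0 ?pi_gt0//= gtr_pMr ?pi_gt0.
rewrite cos_mulr2n cos2sin2 mulr2n.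
have : 0 < sin (pi * r) ^+ 2 by rewrite exprn_gt0.
lra.
Qed.

(* v(t) = e^(-i beta t) u(R_t x) has |v'| equal to the covariant angular
   derivative at R_t x, and v(2 pi) - v(0) = (e^(-2 i pi beta) - 1) u(x). *)
Lemma angular_hardy (p beta : R) : 1 < p -> beta \isn't a Num.int ->
  exists2 K : R, 0 < K & forall f g, of_class_C 1 f -> of_class_C 1 g ->
  (\int[leb2]_x (norm2 (f x, g x) `^ p * norm2 x `^ (- p))%:E <=
   K%:E * \int[leb2]_x (norm2 (angular_derivative f x + beta * g x,
     angular_derivative g x - beta * f x) `^ p * norm2 x `^ (- p))%:E)%E.
Proof.
move=> p1 nint.
have p0 : 0 < p by lra.
have T0 : 0 < pi *+ 2 :> R by rewrite pmulrn_lgt0// pi_gt0.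
have C1 := cos_lt1_nonint nint.
set C := cos _ in C1; pose S := sin (pi *+ 2 * beta).
have CS : C ^+ 2 + S ^+ 2 = 1 by exact: cos2Dsin2.
(* [gam] is the modulus of e^(-2 i pi beta) - 1, as (C-1)^2 + S^2 = 2 - 2C. *)
pose gam := Num.sqrt (2 - 2 * C).
have gam0 : 0 < gam by rewrite sqrtr_gt0; lra.
(* The power of [gam] offsets the size of the displacement; the other factor is the Jensen weight of
   the uniform density on one turn. *)
pose kap := gam `^ (- p) * (pi *+ 2)^-1 `^ (1 - p).
have kap0 : 0 < kap by rewrite mulr_gt0 ?powR_gt0// invr_gt0.
exists (kap * (pi *+ 2)) => [|f g Cf Cg]; first exact: mulr_gt0.
have [[cf _ _ _] [cg _ _ _]] := (Cf, Cg).
have cAf := continuous_angular_derivative Cf.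
have cAg := continuous_angular_derivative Cg.
pose v1 x := angular_derivative f x + beta * g x.
pose v2 x := angular_derivative g x - beta * f x.
have cv1 : continuous v1.
  move=> x; apply: cvgD; [exact: cAf|apply: cvgM; [exact: cvg_cst|exact: cg]].
have cv2 : continuous v2.
  move=> x; apply: cvgB; [exact: cAg|apply: cvgM; [exact: cvg_cst|exact: cf]].
have -> : (kap * (pi *+ 2))%:E =
    (\int[mu]_(t in `[0%R, (pi *+ 2)%R]) (cst kap t)%:E)%E.
  rewrite [RHS](_ : _ = kap%:E * mu `[0%R, (pi *+ 2)%R])%E; last first.
    have mI : measurable (`[0%R, pi *+ 2]%classic : set (measurableTypeR R)).
      exact: measurable_itv.
    by rewrite -(@integral_cst _ _ R mu _ mI kap%:E).
  rewrite lebesgue_measure_itv/= lte_fin T0.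
  by rewrite -EFinB subr0 EFinM.
apply: (@le_integral_conformal_average _ _ _ cos sin) => //.
- by apply: continuous_measurable_fun; exact: continuous_cos.
- by apply: continuous_measurable_fun; exact: continuous_sin.
- exact: measurable_weighted.
- exact: (measurable_weighted p cv1 cv2).
- by move=> t; exact: ltW.
- by move=> t; rewrite cos2Dsin2.
- by move=> x; rewrite mulr_ge0 ?powR_ge0.
- by move=> x; rewrite mulr_ge0 ?powR_ge0.
move=> x.
have crot (v : R * R -> R) : continuous v ->
    continuous (fun t => v (rotation t x)).
  move=> cv; apply: (continuous_along cv) => t.
    by apply: cvgB; apply: cvgM; try exact: cvg_cst;
      [exact: continuous_cos|exact: continuous_sin].
  by apply: cvgD; apply: cvgM; try exact: cvg_cst;
    [exact: continuous_sin|exact: continuous_cos].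
pose z t := norm2 (v1 (rotation t x), v2 (rotation t x)) `^ p *
  (pi *+ 2)^-1 `^ (1 - p).
have z0 t : 0 <= z t by rewrite mulr_ge0 ?powR_ge0.
have mz : measurable_fun setT z.
  apply: measurable_funM => //; apply: measurable_powR_fun.
  by apply: measurable_norm2; apply: continuous_measurable_fun; exact: crot.
rewrite [leRHS](_ : _ = \int[mu]_(t in `[0%R, (pi *+ 2)%R])
    ((gam `^ (- p) * norm2 x `^ (- p))%:E * (z t)%:E))%E; last first.
  apply: eq_integral => t _; rewrite -EFinM; congr EFin.
  rewrite -/(rotation t x) norm2_rotation cos2Dsin2 mulr1 /kap /z /v1 /v2/=.
  by rewrite mulrACA [RHS]mulrACA [X in _ * X = _]mulrC.
rewrite ge0_integralZl//; last 3 first.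
- by apply/measurable_EFinP; exact: measurable_funTS.
- by move=> t _; rewrite lee_fin.
- by rewrite lee_fin mulr_ge0 ?powR_ge0.
have -> : norm2 (f x, g x) `^ p * norm2 x `^ (- p) =
    gam `^ (- p) * norm2 x `^ (- p) * (gam * norm2 (f x, g x)) `^ p.
  rewrite powRM ?norm2_ge0 ?(ltW gam0)// (powRN gam); field.
  by rewrite powR_eq0 (gt_eqF gam0).
rewrite EFinM; apply: lee_wpmul2l; first by rewrite lee_fin mulr_ge0 ?powR_ge0.
pose ct t := cos (beta * t); pose st t := sin (beta * t).
(* [V1], [V2] are the real and imaginary parts of e^(-i beta t) u(R_t x); [w1], [w2] are those of
   its derivative, the same phase times the covariant angular derivative. *)
pose V1 t := ct t * f (rotation t x) + st t * g (rotation t x).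
pose V2 t := ct t * g (rotation t x) - st t * f (rotation t x).
pose w1 t := ct t * v1 (rotation t x) + st t * v2 (rotation t x).
pose w2 t := ct t * v2 (rotation t x) - st t * v1 (rotation t x).
have dct t : is_derive t (1 : R) ct (- beta * st t).
  by apply: is_derive_eq; rewrite /st /GRing.scale/=; ring.
have dst t : is_derive t (1 : R) st (beta * ct t).
  by apply: is_derive_eq; rewrite /ct /GRing.scale/=; ring.
have cct : continuous ct.
  by move=> t; apply: continuous_comp;
    [exact: mulrl_continuous|exact: continuous_cos].
have cst' : continuous st.
  by move=> t; apply: continuous_comp;
    [exact: mulrl_continuous|exact: continuous_sin].
have dV1 t : is_derive t (1 : R) V1 (w1 t).
  have df := is_derive_rotation x t Cf; have dg := is_derive_rotation x t Cg.
  have d1 := dct t; have d2 := dst t.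
  rewrite /V1 /w1 /v1 /v2; apply: is_derive_eq; rewrite /GRing.scale/=; ring.
have dV2 t : is_derive t (1 : R) V2 (w2 t).
  have df := is_derive_rotation x t Cf; have dg := is_derive_rotation x t Cg.
  have d1 := dct t; have d2 := dst t.
  rewrite /V2 /w2 /v1 /v2; apply: is_derive_eq; rewrite /GRing.scale/=; ring.
have cw1 : continuous w1.
  by move=> t; apply: cvgD; apply: cvgM;
    [exact: cct|exact: crot|exact: cst'|exact: crot].
have cw2 : continuous w2.
  by move=> t; apply: cvgB; apply: cvgM;
    [exact: cct|exact: crot|exact: cst'|exact: crot].
have dK t : is_derive t (1 : R) (fun t => t * (pi *+ 2)^-1) ((pi *+ 2)^-1).
  by apply: is_derive_eq; rewrite /GRing.scale/=; ring.
have := @displacement_powR_le _ p 0 (pi *+ 2) V1 V2 w1 w2 _ (cst (pi *+ 2)^-1)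
  p1 T0 dV1 dV2 dK cw1 cw2.
have -> : norm2 (V1 (pi *+ 2) - V1 0, V2 (pi *+ 2) - V2 0) =
    gam * norm2 (f x, g x).
  have r0 : rotation 0 x = x.
    by rewrite /rotation cos0 sin0; case: (x) => a b /=; congr (_, _); ring.
  have r2 : rotation (pi *+ 2) x = x.
    by rewrite /rotation cos2pi sin2pi; case: (x) => a b /=; congr (_, _); ring.
  rewrite /V1 /V2 r0 r2 /ct /st mulr0 cos0 sin0 (mulrC beta) -/C -/S.
  rewrite /gam /norm2 -sqrtrM/=; last by lra.
  congr Num.sqrt.
  transitivity (((C - 1) ^+ 2 + S ^+ 2) * (f x ^+ 2 + g x ^+ 2)); first by ring.
  have -> : S ^+ 2 = 1 - C ^+ 2 by lra.
  by ring.
have cT : continuous (cst (pi *+ 2)^-1 : R -> R) by move=> t; exact: cvg_cst.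
have iT0 (t : R) : 0 < cst (pi *+ 2 : R)^-1 t by rewrite invr_gt0.
have KT : pi *+ 2 / (pi *+ 2) - 0 / (pi *+ 2) <= 1 :> R.
  by rewrite mul0r subr0 divff// gt_eqF.
move=> /(_ cT iT0 KT)/le_trans; apply.
(* The phase has modulus 1, so (w1, w2) and (v1, v2) have the same norm. *)
rewrite le_eqVlt; apply/orP; left; apply/eqP; apply: eq_integral => t _.
congr (EFin (_ `^ p * _)); rewrite /norm2 /w1 /w2/=; congr Num.sqrt.
have : ct t ^+ 2 + st t ^+ 2 = 1 by exact: cos2Dsin2.
move=> /(congr1 (fun y =>
  y * (v1 (rotation t x) ^+ 2 + v2 (rotation t x) ^+ 2))).
by rewrite mul1r => <-; ring.
Qed.

End hardy.

(** * Radial and angular parts of the magnetic gradient *)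

Section magnetic_gradient.
Context {R : realType}.
Implicit Types (u : R * R -> R[i]) (x : R * R).

Lemma normc_norm2 (z : R[i]) :
  Normc.normc z = norm2 (complex.Re z, complex.Im z).
Proof. by case: z. Qed.

(* Concavity of r |-> r^(p/2) with weights 1 - e and e = s^(-2/p); the factor
   e s of b^p is then e^(1-p/2). *)
Lemma weighted_powR_le_norm2 (p s a b : R) : 0 < p -> p <= 2 -> 1 <= s ->
  0 <= a -> 0 <= b ->
  (1 - s `^ (- (2 / p))) * a `^ p + s `^ (- (2 / p)) * s * b `^ p <=
  norm2 (a, b) `^ p.
Proof.
move=> p0 p2 s1 a0 b0.
have s0 : 0 < s by lra.
have q0 : 0 < 2 / p by rewrite divr_gt0.
have q1 : 1 <= 2 / p by rewrite ler_pdivlMr// mul1r.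
set e := s `^ _.
have e01 : 0 <= e <= 1.
  rewrite powR_ge0/= /e powRN invf_le1 ?powR_gt0//.
  exact: le_trans s1 (le1r_powR s1 q1).
case/andP: (e01) => e0 e1.
set z := (X in X <= _).
have z0 : 0 <= z by rewrite addr_ge0// !mulr_ge0 ?powR_ge0// ?subr_ge0// ltW.
(* Raised to the power 2/p, the claim follows from convexity of r^(2/p) at s b^p and a^p with
   weights e and 1 - e: the choice of [e] gives e s^(2/p) = 1, and (1-e) a^2 <= a^2. *)
suff : z `^ (2 / p) <= norm2 (a, b) ^+ 2.
  move=> /(ge0_ler_powR (r := p / 2)).
  rewrite !nnegrE ?powR_ge0 ?sqr_ge0 -powRrM => /(_ _ isT isT).
  have -> : 2 / p * (p / 2) = 1 by field; rewrite gt_eqF.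
  rewrite powRr1// -powR_mulrn ?norm2_ge0// -powRrM.
  have -> : 2%:R * (p / 2) = p by field.
  by apply; rewrite divr_ge0// ltW.
have powRK (y : R) : 0 <= y -> (y `^ p) `^ (2 / p) = y ^+ 2.
  move=> y0; rewrite -powRrM -powR_mulrn//.
  by congr (_ `^ _); field; rewrite gt_eqF.
have := @convex_powR R (2 / p) q1 (Itv01 e0 e1) (s * b `^ p) (a `^ p).
rewrite !inE/= !in_itv/= !andbT !mulr_ge0 ?powR_ge0 ?(ltW s0)// => /(_ isT isT).
move=> h; rewrite convRE [X in X `^ _ <= _]convRE/= /unstable.onem in h.
have -> : z = e * (s * b `^ p) + (1 - e) * a `^ p by rewrite /z; ring.
apply: (le_trans h).
rewrite (powRM _ (ltW s0)) ?powR_ge0// !powRK//.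
rewrite sqr_norm2/= mulrA [e * _](_ : _ = 1); last first.
  by rewrite /e powRN mulVf// powR_eq0 (gt_eqF s0).
rewrite mul1r addrC lerD2r ler_piMl ?sqr_ge0//; lra.
Qed.

(** Real and imaginary parts of (x_1 d_2 - x_2 d_1) u - i beta u; the term in [beta] comes from x_1
    A_2 - x_2 A_1 = -beta. *)
Definition covariant_angular beta u x : R * R :=
  (angular_derivative (re_fun u) x + beta * im_fun u x,
   angular_derivative (im_fun u) x - beta * re_fun u x).

(** The potential is orthogonal to x, hence absent here. *)
Definition covariant_radial u x : R * R :=
  (radial_derivative (re_fun u) x, radial_derivative (im_fun u) x).

Lemma normC2_magnetic_gradient (A : R * R -> R * R) u x :
  normC2 (magnetic_gradient A u x) = Num.sqrt (
    ('D_basis1 (re_fun u) x - (A x).1 * im_fun u x) ^+ 2 +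
    ('D_basis1 (im_fun u) x + (A x).1 * re_fun u x) ^+ 2 +
    (('D_basis2 (re_fun u) x - (A x).2 * im_fun u x) ^+ 2 +
     ('D_basis2 (im_fun u) x + (A x).2 * re_fun u x) ^+ 2)).
Proof.
rewrite /normC2; set z := magnetic_gradient A u x.
rewrite !normc_norm2 !sqr_norm2; congr Num.sqrt.
rewrite /z /magnetic_gradient/= /partialC /re_fun /im_fun.
case: (u x) => a b /=.
by congr (_ ^+ 2 + _ ^+ 2 + (_ ^+ 2 + _ ^+ 2)); ring.
Qed.

(** Lagrange's identity |x|^2 |V|^2 = (x.V)^2 + (x_1 V_2 - x_2 V_1)^2, for V the real and then the
    imaginary part of the magnetic gradient. *)
Lemma normC2_AB_gradient (beta : R) u x : norm2 x != 0 ->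
  normC2 (magnetic_gradient (AB_potential beta) u x) =
  norm2 (norm2 (covariant_radial u x) / norm2 x,
         norm2 (covariant_angular beta u x) / norm2 x).
Proof.
move=> x0; rewrite normC2_magnetic_gradient [RHS]/norm2/=; congr Num.sqrt.
rewrite !exprMn -mulrDl !sqr_norm2/= /radial_derivative /angular_derivative.
have n0 : x.1 ^+ 2 + x.2 ^+ 2 != 0 by rewrite -sqr_norm2 sqrf_eq0.
rewrite exprVn sqr_norm2.
by field.
Qed.

Lemma AB_gradient_lower_bound (p s beta : R) u x : 0 < p -> p <= 2 -> 1 <= s ->
  (1 - s `^ (- (2 / p))) *
    (norm2 (covariant_radial u x) `^ p * norm2 x `^ (- p)) +
  s `^ (- (2 / p)) * s *
    (norm2 (covariant_angular beta u x) `^ p * norm2 x `^ (- p)) <=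
  normC2 (magnetic_gradient (AB_potential beta) u x) `^ p.
Proof.
move=> p0 p2 s1.
(* At the origin the weight of exponent [- p] is 0 by convention, so the bound holds at every
   point. *)
have [x0|x0] := eqVneq (norm2 x) 0.
  by rewrite x0 powR0 ?oppr_eq0 ?gt_eqF// !mulr0 addr0 powR_ge0.
have pV y : 0 <= y -> y `^ p * norm2 x `^ (- p) = (y / norm2 x) `^ p.
  move=> y0; rewrite powRM ?invr_ge0 ?norm2_ge0//; congr (_ * _).
  by rewrite -powR_inv1 ?norm2_ge0// -powRrM mulN1r.
rewrite !pV ?norm2_ge0// normC2_AB_gradient//.
by apply: weighted_powR_le_norm2; rewrite ?divr_ge0 ?norm2_ge0.
Qed.

Lemma measurable_AB_gradient (beta : R) u :
  of_class_C 1 (re_fun u) -> of_class_C 1 (im_fun u) ->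
  measurable_fun setT
    (fun x => normC2 (magnetic_gradient (AB_potential beta) u x)).
Proof.
move=> [cf _ cf1 cf2] [cg _ cg1 cg2].
under eq_fun do rewrite normC2_magnetic_gradient.
have mn : measurable_fun setT (fun x : R * R => (norm2 x ^+ 2)^-1).
  rewrite (_ : (fun _ => _) = (fun x => (norm2 (x.1, x.2) ^+ 2) `^ (- 1))).
    apply: measurable_powR_fun; apply: measurable_funX; apply: measurable_norm2.
      exact: measurable_fst.
    exact: measurable_snd.
  by apply/funext => -[a b]; rewrite powR_inv1// sqr_ge0.
have mA1 : measurable_fun setT (fun x => (AB_potential beta x).1).
  by apply: measurable_funM => //; exact: measurable_funM.
have mA2 : measurable_fun setT (fun x => (AB_potential beta x).2).
  apply: measurable_funM => //; apply: measurable_funM => //.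
  by apply: measurable_funN; exact: measurable_fst.
have mc := @continuous_measurable_prod R.
apply: (@measurableT_comp _ _ _ _ _ _ (@Num.sqrt R)).
  by apply: continuous_measurable_fun; exact: sqrt_continuous.
apply: measurable_funD; apply: measurable_funD; apply: measurable_funX.
- exact: (measurable_funB (mc _ cf1) (measurable_funM mA1 (mc _ cg))).
- exact: (measurable_funD (mc _ cg1) (measurable_funM mA1 (mc _ cf))).
- exact: (measurable_funB (mc _ cf2) (measurable_funM mA2 (mc _ cg))).
- exact: (measurable_funD (mc _ cg2) (measurable_funM mA2 (mc _ cf))).
Qed.

End magnetic_gradient.

(** * Support bound and combination of the two Hardy inequalities *)

Lemma test_function_vanishes {R : realType} (u : R * R -> R[i]) :
  test_function u ->
  exists M, forall x, M < norm2 x -> re_fun u x = 0 /\ im_fun u x = 0.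
Proof.
move=> [_ _ /compact_bounded [M [_ MP]]].
(* On the support the max norm is at most [M + 1]; the factor 2 covers the ratio, at most sqrt 2, of
   the Euclidean norm to it. *)
exists ((M + 1) *+ 2) => x xM.
suff u0 : u x = 0 by rewrite /re_fun /im_fun u0.
apply/eqP; apply: contraTT xM => ux; rewrite -leNgt.
have xle : `|x| <= M + 1.
  by apply: MP; [rewrite ltrDl|exact: subset_closure].
have [x1 x2] : `|x.1| <= M + 1 /\ `|x.2| <= M + 1.
  by move: xle; rewrite prod_normE ge_max => /andP[].
have M0 : 0 <= M + 1 by exact: le_trans x1.
rewrite -(ler_pXn2r (n := 2)) ?nnegrE ?norm2_ge0 ?mulrn_wge0//.
rewrite sqr_norm2 -(real_normK (num_real x.1)) -(real_normK (num_real x.2)).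
have := ler_pM (normr_ge0 _) (normr_ge0 _) x1 x1.
have := ler_pM (normr_ge0 _) (normr_ge0 _) x2 x2.
have := mulr_ge0 M0 M0.
rewrite mulr2n !expr2; lra.
Qed.

Lemma lee_weighted_sum {R : realType} (a b k l : R) (x y z : \bar R) :
  0 <= a -> 0 <= b -> 0 <= k -> 0 <= l -> (0 <= x)%E ->
  (k%:E * x <= y)%E -> (l%:E * x <= z)%E ->
  ((a * k + b * l)%:E * x <= a%:E * y + b%:E * z)%E.
Proof.
move=> a0 b0 k0 l0 x0 kx lx.
rewrite EFinD ge0_muleDl ?lee_fin ?mulr_ge0// !EFinM -!muleA.
by apply: leeD; apply: lee_wpmul2l; rewrite ?lee_fin.
Qed.

Theorem theorem1p4 (R : realType) (p : R) (hp1 : 1 < p) (hp2 : p < 2)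
    (beta : R) (hbeta : beta \isn't a Num.int) :
  exists lambda : R,
    ((2 - p) / p) `^ p < lambda /\
    forall u : R * R -> R[i], test_function u ->
      (lambda%:E * \int[leb2]_(x in setT)
          (Normc.normc (u x) `^ p / norm2 x `^ p)%:E <=
       \int[leb2]_(x in setT)
          (normC2 (magnetic_gradient (AB_potential beta) u x) `^ p)%:E)%E.
Proof.
have p0 : 0 < p by lra.
set c := (2 - p) / p.
have c0 : 0 < c by rewrite divr_gt0// subr_gt0.
have [K K0 angular] := angular_hardy hp1 hbeta.
(* [s > 1] makes the weight [e] less than 1, and s/K = c^p + 1/K makes the constant exceed c^p by
   exactly e/K. *)
pose s := 1 + K * c `^ p.
have Kc0 : 0 < K * c `^ p by rewrite mulr_gt0 ?powR_gt0.
have s1 : 1 < s by rewrite /s ltrDl.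
have s0 : 0 < s by lra.
pose e := s `^ (- (2 / p)).
have e0 : 0 < e by exact: powR_gt0.
have e1 : e < 1.
  rewrite /e powRN invf_lt1 ?powR_gt0//.
  apply: (lt_le_trans s1); apply: le1r_powR; first exact: ltW.
  by rewrite ler_pdivlMr// mul1r ltW.
have e1_ge0 : 0 <= 1 - e by lra.
have es_ge0 : 0 <= e * s by rewrite mulr_ge0// ltW.
exists ((1 - e) * c `^ p + e * s / K); split.
  rewrite mulrBl mul1r -addrA ltrDl addrC subr_gt0 -mulrA ltr_pM2l//.
  by rewrite ltr_pdivlMr// mulrC /s ltrDr.
move=> u tu; have [sf sg _] := tu.
have Cf := sf 1%N; have Cg := sg 1%N.
have [[cf _ _ _] [cg _ _ _]] := (Cf, Cg).
have normE x : Normc.normc (u x) `^ p / norm2 x `^ p =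
    norm2 (re_fun u x, im_fun u x) `^ p * norm2 x `^ (- p).
  by rewrite normc_norm2 powRN.
pose I := (\int[leb2]_x
  (norm2 (re_fun u x, im_fun u x) `^ p * norm2 x `^ (- p))%:E)%E.
rewrite [X in (_ * X)%E](_ : _ = I); last first.
  by apply: eq_integral => x _; rewrite normE.
pose radial x := norm2 (covariant_radial u x) `^ p * norm2 x `^ (- p).
pose angul x := norm2 (covariant_angular beta u x) `^ p * norm2 x `^ (- p).
have I0 : (0 <= I)%E.
  by apply: integral_ge0 => x _; rewrite lee_fin mulr_ge0 ?powR_ge0.
have radial0 x : 0 <= radial x by rewrite mulr_ge0 ?powR_ge0.
have angul0 x : 0 <= angul x by rewrite mulr_ge0 ?powR_ge0.
have mradial : measurable_fun setT (fun x => (radial x)%:E).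
  by apply/measurable_EFinP; apply: measurable_weighted;
    exact: continuous_radial_derivative.
have mangul : measurable_fun setT (fun x => (angul x)%:E).
  apply/measurable_EFinP; apply: measurable_weighted => x.
    apply: cvgD; first exact: continuous_angular_derivative.
    by apply: cvgM; [exact: cvg_cst|exact: cg].
  apply: cvgB; first exact: continuous_angular_derivative.
  by apply: cvgM; [exact: cvg_cst|exact: cf].
have radialI : ((c `^ p)%:E * I <= \int[leb2]_x (radial x)%:E)%E.
  rewrite -lee_pdivlMl ?powR_gt0// -powRN.
  exact: (radial_hardy hp1 hp2 Cf Cg (test_function_vanishes tu)).
have angulI : ((K^-1)%:E * I <= \int[leb2]_x (angul x)%:E)%E.
  rewrite -lee_pdivlMl ?invr_gt0// invrK.
  exact: (angular _ _ Cf Cg).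
apply: (@le_trans _ _ (\int[leb2]_x
    ((1 - e)%:E * (radial x)%:E + (e * s)%:E * (angul x)%:E))%E); last first.
  apply: ge0_le_integral => //.
  - move=> x _; rewrite -!EFinM -EFinD lee_fin.
    exact: addr_ge0 (mulr_ge0 e1_ge0 (radial0 x)) (mulr_ge0 es_ge0 (angul0 x)).
  - exact: (emeasurable_funD (measurable_funeM _ mradial)
      (measurable_funeM _ mangul)).
  - apply/measurable_EFinP; apply: measurable_powR_fun.
    exact: measurable_AB_gradient.
  - move=> x _; rewrite -!EFinM -EFinD lee_fin.
    by apply: AB_gradient_lower_bound => //; exact: ltW.
rewrite ge0_integralD//; last 4 first.
- by move=> x _; rewrite -EFinM lee_fin; exact: mulr_ge0 e1_ge0 (radial0 x).
- exact: (measurable_funeM _ mradial).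
- by move=> x _; rewrite -EFinM lee_fin; exact: mulr_ge0 es_ge0 (angul0 x).
- exact: (measurable_funeM _ mangul).
have intZ (k : R) (h : R * R -> R) : 0 <= k ->
    measurable_fun setT (fun x => (h x)%:E) -> (forall x, 0 <= h x) ->
    (\int[leb2]_x (k%:E * (h x)%:E) = k%:E * \int[leb2]_x (h x)%:E)%E.
  by move=> k0 mh h0; apply: ge0_integralZl => // x _; rewrite lee_fin.
rewrite (intZ _ _ e1_ge0 mradial radial0) (intZ _ _ es_ge0 mangul angul0).
have iK0 : 0 <= K^-1 by rewrite invr_ge0 ltW.
exact: (lee_weighted_sum e1_ge0 es_ge0 (powR_ge0 c p) iK0 I0 radialI angulI).
Qed.
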